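(* For all $k\ge1$ and $n\ge2$, the Burau matrix of the $k$-th power of the full twist on $n$ strands is given by $$\psi(\Omega_n^k)_{ij}=\begin{cases}T^{j-1}p_{n,k}& i\neq j\\[2pt] 1-p_{n,k}\Big(\sum_{m=1,\,m\ne i}^nT^{m-1}\Big)& i=j,\end{cases}\qquad\text{where}\qquad p_{n,k}=(1-T)\sum_{l=0}^{k-1}T^{nl}.$$
   Context: $B_n$ is the $n$-strand braid group with standard generators $\sigma_1,\dots,\sigma_{n-1}$, and $\Omega_n=(\sigma_1\sigma_2\cdots\sigma_{n-1})^n\in B_n$ is the full twist. The (unreduced) Burau representation $\psi:B_n\to\mathrm{GL}_n(\mathbb{Z}[T,T^{-1}])$ is determined by $$\psi(\sigma_k)=\begin{bmatrix}I_{k-1}&0&0&0\\0&1-T&T&0\\0&1&0&0\\0&0&0&I_{n-k-1}\end{bmatrix},\qquad k=1,\dots,n-1.$$ *)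

(* Defs.v *)
From HB Require Import structures.
From mathcomp Require Import all_boot all_order all_algebra.
From mathcomp Require Import fraction generic_quotient.
From mathcomp Require Import boolp.
From mathcomp Require Import ring.

Set Implicit Arguments.
Unset Strict Implicit.
Unset Printing Implicit Defensive.

Import GRing.Theory.
Local Open Scope ring_scope.
Local Open Scope quotient_scope.

(* Z[T, T^-1], as the subring of the x in Frac(Z[T]) such that x * T^m lies   *)
(* in Z[T] for some m.                                                        *)
Definition is_laurent : {pred {fraction {poly int}}} :=
  fun x => `[< exists (m : nat) (p : {poly int}),
               x * tofrac 'X ^+ m = tofrac p >].

Lemma is_laurent_subring : subring_closed is_laurent.
Proof.
split=> [|x y /asboolP[m [p xp]] /asboolP[l [q yq]]
         |x y /asboolP[m [p xp]] /asboolP[l [q yq]]]; apply/asboolP.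
- by exists 0, 1; rewrite expr0 mulr1 tofrac1.
- exists (m + l), (p * 'X^l - q * 'X^m).
  by rewrite tofracB !tofracM !tofracXn -xp -yq exprD; ring.
- by exists (m + l), (p * q); rewrite tofracM -xp -yq exprD mulrACA.
Qed.

HB.instance Definition _ :=
  GRing.isSubringClosed.Build _ is_laurent is_laurent_subring.

Record laurent := Laurent {
  laurent_val : {fraction {poly int}};
  laurent_valP : laurent_val \in is_laurent }.

HB.instance Definition _ := [isSub for laurent_val].
HB.instance Definition _ := [Choice of laurent by <:].
HB.instance Definition _ := [SubChoice_isSubComNzRing of laurent by <:].

Definition laurent_unit : {pred laurent} := fun x => `[< exists y, y * x = 1 >].

Definition laurent_inv (x : laurent) : laurent :=
  if pselect (exists y, y * x = 1) is left ex then projT1 (cid ex) else x.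

Lemma laurent_mulVx : {in laurent_unit, left_inverse 1 laurent_inv *%R}.
Proof.
move=> x /asboolP xU; rewrite /laurent_inv.
by case: pselect => // ex; case: cid.
Qed.

Lemma laurent_unitPl (x y : laurent) : y * x = 1 -> laurent_unit x.
Proof. by move=> yx; apply/asboolP; exists y. Qed.

Lemma laurent_inv_out : {in [predC laurent_unit], laurent_inv =1 id}.
Proof.
move=> x /asboolP xU; rewrite /laurent_inv.
by case: pselect.
Qed.

HB.instance Definition _ := GRing.ComNzRing_hasMulInverse.Build laurent
  laurent_mulVx laurent_unitPl laurent_inv_out.

Fact laurent_T_subproof : tofrac 'X \in is_laurent.
Proof. by apply/asboolP; exists 0, 'X; rewrite expr0 mulr1. Qed.

Definition varT : laurent := Laurent laurent_T_subproof.

Lemma laurent_T_unit : varT \is a GRing.unit.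
Proof.
have X0 : tofrac 'X != 0 :> {fraction {poly int}}.
  by rewrite tofrac_eq0 polyX_eq0.
have VX : (tofrac 'X)^-1 \in is_laurent.
  by apply/asboolP; exists 1, 1; rewrite expr1 mulVf ?tofrac1.
apply/asboolP; exists (Laurent VX); apply: val_inj.
by rewrite /= mulVf.
Qed.

Section GeneralLinear.
Variables (R : comUnitRingType) (n : nat).

Record general_linear := GlMx { gl_val :> 'M[R]_n; gl_valP : gl_val \in unitmx }.

HB.instance Definition _ := [isSub for gl_val].
HB.instance Definition _ := [Choice of general_linear by <:].

Fact gl_mul_subproof (A B : general_linear) : gl_val A *m gl_val B \in unitmx.
Proof. by rewrite unitmx_mul !gl_valP. Qed.

Fact gl_inv_subproof (A : general_linear) : invmx A \in unitmx.
Proof. by rewrite unitmx_inv gl_valP. Qed.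

Definition gl_one := GlMx (unitmx1 R n).
Definition gl_mul A B := GlMx (gl_mul_subproof A B).
Definition gl_inv A := GlMx (gl_inv_subproof A).

Lemma gl_mulA : associative gl_mul.
Proof. by move=> A B C; apply: val_inj; rewrite /= mulmxA. Qed.

Lemma gl_mul1 : left_id gl_one gl_mul.
Proof. by move=> A; apply: val_inj; rewrite /= mul1mx. Qed.

Lemma gl_mulr1 : right_id gl_one gl_mul.
Proof. by move=> A; apply: val_inj; rewrite /= mulmx1. Qed.

Lemma gl_mulV : left_inverse gl_one gl_inv gl_mul.
Proof. by move=> A; apply: val_inj; rewrite /= mulVmx ?gl_valP. Qed.

Lemma gl_mulrV : right_inverse gl_one gl_inv gl_mul.
Proof. by move=> A; apply: val_inj; rewrite /= mulmxV ?gl_valP. Qed.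

HB.instance Definition _ :=
  isGroup.Build general_linear gl_mulA gl_mul1 gl_mulr1 gl_mulV gl_mulrV.

End GeneralLinear.

(* The letter (k, true) stands for sigma_(k+1) and (k, false) for its         *)
(* inverse: strands and generators are numbered from 0.                       *)
Definition braid_word (n : nat) := seq ('I_n.-1 * bool).

Section BraidGroup.
Variable n : nat.
Implicit Types u v w : braid_word n.

(* The congruence on words generated by free cancellation and Artin's         *)
(* relations.                                                                 *)
Inductive braid_rel : braid_word n -> braid_word n -> Prop :=
| braid_refl u : braid_rel u u
| braid_sym u v : braid_rel u v -> braid_rel v u
| braid_trans u v w : braid_rel u v -> braid_rel v w -> braid_rel u w
| braid_cat u1 u2 v1 v2 :
    braid_rel u1 v1 -> braid_rel u2 v2 -> braid_rel (u1 ++ u2) (v1 ++ v2)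
| braid_cancel i b : braid_rel [:: (i, b); (i, ~~ b)] [::]
| braid_far (i j : 'I_n.-1) : (i.+1 < j)%N ->
    braid_rel [:: (i, true); (j, true)] [:: (j, true); (i, true)]
| braid_near (i j : 'I_n.-1) : j = i.+1 :> nat ->
    braid_rel [:: (i, true); (j, true); (i, true)]
              [:: (j, true); (i, true); (j, true)].

Definition braid_eqb u v : bool := `[< braid_rel u v >].

Lemma braid_eqb_refl : reflexive braid_eqb.
Proof. by move=> u; apply/asboolP; apply: braid_refl. Qed.

Lemma braid_eqb_sym : symmetric braid_eqb.
Proof. by move=> u v; apply/asboolP/asboolP; apply: braid_sym. Qed.

Lemma braid_eqb_trans : transitive braid_eqb.
Proof.
by move=> v u w /asboolP uv /asboolP vw; apply/asboolP; apply: braid_trans uv vw.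
Qed.

Canonical braid_equiv :=
  EquivRel braid_eqb braid_eqb_refl braid_eqb_sym braid_eqb_trans.

Definition braid := {eq_quot braid_equiv}.

HB.instance Definition _ := Choice.on braid.
HB.instance Definition _ := EqQuotient.on braid.

Lemma braidP u v : \pi_braid u = \pi_braid v <-> braid_rel u v.
Proof. by split=> [/eqmodP/asboolP | uv]; last exact/eqmodP/asboolP. Qed.

Lemma braid_repr u : braid_rel (repr (\pi_braid u)) u.
Proof. by apply/braidP; rewrite reprK. Qed.

Definition word_inv u : braid_word n := rev [seq (x.1, ~~ x.2) | x <- u].

Definition braid_one : braid := \pi_braid [::].
Definition braid_mul (x y : braid) : braid := \pi_braid (repr x ++ repr y).
Definition braid_inv (x : braid) : braid := \pi_braid (word_inv (repr x)).

Lemma word_mulrV u : braid_rel (u ++ word_inv u) [::].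
Proof.
elim: u => [|[i b] u IHu]; first exact: braid_refl.
rewrite /word_inv /= rev_cons -cats1 catA -cat1s -!catA.
apply: braid_trans (braid_cancel i b).
rewrite -[[:: (i, b); _]]/([:: (i, b)] ++ ([::] ++ [:: (i, ~~ b)])).
apply: braid_cat; first exact: braid_refl.
by rewrite catA; apply: braid_cat; [exact: IHu | exact: braid_refl].
Qed.

Lemma word_invK : involutive word_inv.
Proof.
move=> u; rewrite /word_inv map_rev revK -map_comp -[RHS]map_id.
by apply: eq_map => -[i b] /=; rewrite negbK.
Qed.

Lemma word_mulV u : braid_rel (word_inv u ++ u) [::].
Proof. by rewrite -[u in _ ++ u]word_invK; apply: word_mulrV. Qed.

Lemma braid_mulE u v : braid_mul (\pi_braid u) (\pi_braid v) = \pi_braid (u ++ v).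
Proof. by apply/braidP; apply: braid_cat; apply: braid_repr. Qed.

Lemma braid_mulA : associative braid_mul.
Proof.
elim/quotW=> u; elim/quotW=> v; elim/quotW=> w.
by rewrite (braid_mulE v w) (braid_mulE u v) !braid_mulE catA.
Qed.

Lemma braid_mul1 : left_id braid_one braid_mul.
Proof. by elim/quotW=> u; rewrite braid_mulE. Qed.

Lemma braid_mulr1 : right_id braid_one braid_mul.
Proof. by elim/quotW=> u; rewrite braid_mulE cats0. Qed.

Lemma braid_mulV : left_inverse braid_one braid_inv braid_mul.
Proof.
move=> x; rewrite /braid_inv -[x in braid_mul _ x]reprK braid_mulE.
by apply/braidP; apply: word_mulV.
Qed.

Lemma braid_mulrV : right_inverse braid_one braid_inv braid_mul.
Proof.
move=> x; rewrite /braid_inv -[x in braid_mul x]reprK braid_mulE.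
by apply/braidP; apply: word_mulrV.
Qed.

HB.instance Definition _ := isGroup.Build braid
  braid_mulA braid_mul1 braid_mulr1 braid_mulV braid_mulrV.

Definition sigma (k : 'I_n.-1) : braid := \pi_braid [:: (k, true)].

(* The product of the generators is taken in increasing order of index.       *)
Definition full_twist : braid := ((\prod_(k < n.-1) sigma k) ^+ n)%g.

Lemma braid_sigmaV k : \pi_braid [:: (k, false)] = (sigma k)^-1%g.
Proof.
apply: (mulgI (sigma k)); rewrite mulgV.
by rewrite [LHS]braid_mulE; apply/braidP; apply: (braid_cancel k true).
Qed.

End BraidGroup.

(* With k numbered from 0, the 2 x 2 block occupies rows and columns k, k+1.  *)
Definition burau_mx (R : comNzRingType) (t : R) (n k : nat) : 'M[R]_n :=
  \matrix_(i, j)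
    if i == k :> nat then
      if j == k :> nat then 1 - t else if j == k.+1 :> nat then t else 0
    else if i == k.+1 :> nat then (j == k :> nat)%:R
    else (i == j)%:R.

Section BurauMatrices.
Variables (R : comUnitRingType) (t : R) (n : nat).
Implicit Types k l : nat.

Let u k : 'cV[R]_n :=
  \col_i ((i == k.+1 :> nat)%:R - t * (i == k :> nat)%:R).
Let v k : 'rV[R]_n := \row_j ((j == k :> nat)%:R - (j == k.+1 :> nat)%:R).

Let burau_mxE k : burau_mx t n k = 1%:M + u k *m v k.
Proof.
apply/matrixP=> i j; rewrite !mxE big_ord1 !mxE -val_eqE /=.
have kk1 : (k == k.+1) = false by rewrite ltn_eqF.
have k1k : (k.+1 == k) = false by rewrite gtn_eqF.
case: (eqVneq (i : nat) k) => [->|_].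
  rewrite kk1 [k == j]eq_sym; case: (eqVneq (j : nat) k) => [->|_].
    by rewrite kk1 /=; ring.
  by case: eqVneq => _ /=; ring.
case: (eqVneq (i : nat) k.+1) => [->|_]; last by rewrite /=; ring.
rewrite [k.+1 == j]eq_sym; case: (eqVneq (j : nat) k) => [->|_].
  by rewrite kk1 /=; ring.
by case: eqVneq => _ /=; ring.
Qed.

Let vu k l : (k.+1 < n)%N -> v k *m u l =
  ((k == l.+1)%:R - t * (k == l)%:R - ((k == l)%:R - t * (k.+1 == l)%:R))%:M.
Proof.
move=> kn; apply/matrixP=> i j; rewrite !ord1 !mxE eqxx mulr1n.
pose k0 := Ordinal (ltnW kn); pose k1 := Ordinal kn.
have k01 : k1 != k0 by rewrite -val_eqE /= (gtn_eqF (ltnSn k)).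
rewrite (bigD1 k0) // (bigD1 k1) //= big1 => [|m /andP[m0 m1]].
  rewrite !mxE /= !eqxx !eqSS (ltn_eqF (ltnSn k)) (gtn_eqF (ltnSn k)) /=.
  by ring.
rewrite !mxE; move: m0 m1; rewrite -!val_eqE /= => /negbTE-> /negbTE->.
by rewrite subrr mul0r.
Qed.

Lemma burau_mx_unit k : t \is a GRing.unit -> (k.+1 < n)%N ->
  burau_mx t n k \in unitmx.
Proof.
move=> tU kn.
have H : burau_mx t n k *m (1%:M + t^-1 *: (u k *m v k)) = 1%:M.
  rewrite burau_mxE mulmxDl mul1mx mulmxDr mulmx1 -!addrA.
  rewrite -[in RHS](addr0 1%:M); congr (_ + _).
  rewrite -scalemxAr mulmxA -(mulmxA (u k)) vu //.
  rewrite eqxx (ltn_eqF (ltnSn k)) (gtn_eqF (ltnSn k)) /=.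
  rewrite mul_mx_scalar -scalemxAl scalerA -[X in _ + (X + _)]scale1r -!scalerDl.
  rewrite [X in X *: _](_ : _ = 0) ?scale0r //.
  by move: (mulVr tU); set s := t^-1 => sU; ring: sU.
by have [] := mulmx1_unit H.
Qed.

Lemma burau_mx_far k l : (k.+1 < l)%N -> (l.+1 < n)%N ->
  burau_mx t n k *m burau_mx t n l = burau_mx t n l *m burau_mx t n k.
Proof.
move=> kl ln; have kn : (k.+1 < n)%N by apply: ltn_trans kl (ltnW ln).
have kl0 : (k < l)%N by apply: ltnW.
rewrite !burau_mxE !(mulmxDl, mulmxDr) !(mul1mx, mulmx1).
have H a b : (a.+1 < n)%N -> a == b.+1 = false -> a == b = false ->
    a.+1 == b = false -> u a *m v a *m (u b *m v b) = 0.
  move=> an e1 e2 e3; rewrite mulmxA -(mulmxA (u a)) vu // e1 e2 e3.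
  by rewrite !mulr0 !subr0 raddf0 mulmx0 mul0mx.
rewrite !H // ?addr0; first by rewrite addrAC.
- by rewrite gtn_eqF.
- by rewrite gtn_eqF.
- by rewrite gtn_eqF // ltnW // ltnW.
- by rewrite ltn_eqF // ltnW.
- by rewrite ltn_eqF.
- by rewrite ltn_eqF.
Qed.

Lemma burau_mx_near k : (k.+2 < n)%N ->
  burau_mx t n k *m burau_mx t n k.+1 *m burau_mx t n k =
  burau_mx t n k.+1 *m burau_mx t n k *m burau_mx t n k.+1.
Proof.
move=> kn; have kn1 : (k.+1 < n)%N by apply: ltnW.
have H a b : (a.+1 < n)%N -> u a *m v a *m (u b *m v b) = 
  ((a == b.+1)%:R - t * (a == b)%:R - ((a == b)%:R - t * (a.+1 == b)%:R))
    *: (u a *m v b).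
  by move=> an; rewrite mulmxA -(mulmxA (u a)) vu // mul_mx_scalar scalemxAl.
have H2 a b c : (a.+1 < n)%N -> u c *m v a *m (u b *m v b) = 
  ((a == b.+1)%:R - t * (a == b)%:R - ((a == b)%:R - t * (a.+1 == b)%:R))
    *: (u c *m v b).
  by move=> an; rewrite mulmxA -(mulmxA (u c)) vu // mul_mx_scalar scalemxAl.
have E0 m : (m == m.+1) = false by rewrite ltn_eqF.
have E1 m : (m.+1 == m) = false by rewrite gtn_eqF.
have E2 m : (m.+2 == m) = false by rewrite gtn_eqF // ltnW.
have E3 m : (m == m.+2) = false by rewrite ltn_eqF // ltnW.
rewrite !burau_mxE !(mulmxDl, mulmxDr) !(mul1mx, mulmx1) !H //.
rewrite -!scalemxAl !H2 // ?eqSS !(E0, E1, E2, E3, eqxx) /=.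
rewrite !scalerA; apply/matrixP=> i j; rewrite !mxE.
ring.
Qed.

End BurauMatrices.

Lemma ord_pred_ltS (n : nat) (k : 'I_n.-1) : (k.+1 < n)%N.
Proof. by case: n k => [[]|n] // k; rewrite ltnS. Qed.

Section Burau.
Variable n : nat.

Definition burau_gen (k : 'I_n.-1) : general_linear laurent n :=
  GlMx (burau_mx_unit laurent_T_unit (ord_pred_ltS k)).

Definition burau_word (w : braid_word n) : general_linear laurent n :=
  (\prod_(x <- w) if x.2 then burau_gen x.1 else (burau_gen x.1)^-1)%g.

Lemma burau_wordP u v : braid_rel u v -> burau_word u = burau_word v.
Proof.
elim=> {u v} //.
- by move=> u v w _ -> _ ->.
- by move=> u1 u2 v1 v2 _ E1 _ E2; rewrite /burau_word !big_cat /=; congr (_ * _)%g.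
- by move=> i []; rewrite /burau_word !big_cons big_nil /= mulg1 ?mulgV ?mulVg.
- move=> i j ij; rewrite /burau_word !big_cons !big_nil /= !mulg1.
  apply: val_inj; exact: (burau_mx_far varT ij (ord_pred_ltS j)).
- move=> i j ij; rewrite /burau_word !big_cons !big_nil /= !mulg1 !mulgA.
  apply: val_inj; rewrite /= ij; apply: burau_mx_near.
  by rewrite -ij; apply: ord_pred_ltS.
Qed.

Definition burau (x : braid n) : general_linear laurent n := burau_word (repr x).

Lemma burauE (w : braid_word n) : burau (\pi_(braid n) w) = burau_word w.
Proof. exact/burau_wordP/braid_repr. Qed.

Fact burau_is_group_morphism :
  (burau 1%g = 1%g) * {morph burau : x y / (x * y)%g}.
Proof.
split=> [|x y]; first by rewrite burauE /burau_word big_nil.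
by rewrite [LHS]burauE /burau_word big_cat.
Qed.

HB.instance Definition _ := isUMagmaMorphism.Build (braid n) (general_linear laurent n)
  burau burau_is_group_morphism.

Lemma burau_sigma (k : 'I_n.-1) :
  gl_val (burau (sigma k)) = burau_mx varT n k.
Proof. by rewrite burauE /burau_word big_cons big_nil /= mulmx1. Qed.

End Burau.

Definition burau_p (n k : nat) : laurent :=
  (1 - varT) * \sum_(l < k) varT ^+ (n * l).

(* Main.v *)
Require Import Defs.
From mathcomp Require Import all_boot all_order all_algebra.
From mathcomp Require Import ring.

(** The full twist acts as the scalar T^n on the span of the differences of
    consecutive standard row vectors, the hyperplane of rows with sum 0, which
    every generator preserves because its
    matrix has rows with sum 1; this determines the Burau matrix of the full
    twist up to a single row.

    Let e_0, ..., e_(n-1) be the standard row vectors, d_l = e_l - e_(l+1), and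
    let A be the matrix of sigma_1 ... sigma_(n-1), so that the full twist has
    matrix A^n.  Multiplying out the generators shows that A is a companion
    matrix: e_(l+1) A = e_l, while e_0 A is an explicit row, which telescopes
    to e_0 - \sum_l T^(l+1) d_l ([row_coxeter0], [coxeter0_telescope]).  So A
    moves the differences cyclically up to a scalar, d_(l+1) to d_l and d_0 A
    to T^n d_(n-2) ([diff_coxeterS], [diff_coxeter0]); going once around the
    cycle takes n steps, hence d_l A^n = T^n d_l for every l
    ([diff_full_twist]).  This says that all the rows of A^n - T^n I are equal.
    The last one is known, because e_(n-1) A^(n-1) = e_0: it is
    (1 - T) (1, T, ..., T^(n-1)).  Therefore
      A^n = T^n I + (1 - T) E,  where E has all its rows (1, T, ..., T^(n-1))
    ([full_twist_mxE]).

    Put S = 1 + T + ... + T^(n-1).  Since E^2 = S E and (1 - T) S = 1 - T^n,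
    the powers are A^(n k) = T^(n k) I + p_(n,k) E ([full_twist_mxX]), and
    p_(n,k) S = 1 - T^(n k) rewrites the diagonal entry T^(n k) + p_(n,k) T^i
    as 1 - p_(n,k) (S - T^i).  *)

Set Implicit Arguments.
Unset Strict Implicit.
Unset Printing Implicit Defensive.

Import GRing.Theory.
Local Open Scope ring_scope.

(** The index is a natural number, so that it can be shifted and summed over
    without casts between ordinals; out of range, the row is 0. *)
Definition unit_row (R : nzRingType) (n l : nat) : 'rV[R]_n :=
  \row_j (j == l :> nat)%:R.

Definition diff_row (R : nzRingType) (n l : nat) : 'rV[R]_n :=
  unit_row R n l - unit_row R n l.+1.

(** The Burau matrix of sigma_1 ... sigma_m on n.+1 strands; for m = n the
    permutation underlying this braid is a Coxeter element of the symmetric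
    group.  The partial products serve for inductions on m. *)
Definition coxeter_mx (R : comNzRingType) (t : R) (n m : nat) : 'M[R]_n.+1 :=
  \prod_(0 <= k < m) burau_mx t n.+1 k.

Definition geom_mx (R : nzRingType) (t : R) (n : nat) : 'M[R]_n :=
  \matrix_(i, j) t ^+ j.

Definition geom_row (R : nzRingType) (t : R) (n : nat) : 'rV[R]_n :=
  \row_j t ^+ j.

Lemma unit_row_mul (R : nzRingType) (n p : nat) (i : 'I_n) (M : 'M[R]_(n, p)) :
  unit_row R n i *m M = row i M.
Proof.
rewrite rowE; congr (_ *m _); apply/rowP=> j.
by rewrite !mxE eqxx.
Qed.

Lemma geom_rowE (R : nzRingType) (t : R) (n : nat) :
  geom_row t n = \sum_(0 <= j < n) t ^+ j *: unit_row R n j.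
Proof.
apply/rowP=> i; rewrite big_mkord summxE mxE (bigD1 i) //= !mxE eqxx mulr1.
rewrite big1 ?addr0 // => j ji.
by rewrite !mxE (_ : (i == j :> nat) = false) ?mulr0 // eq_sym; apply/negbTE.
Qed.

Section Coxeter.
Variables (R : comNzRingType) (t : R) (n : nat).

Local Notation e l := (unit_row R n.+1 l).
Local Notation d l := (diff_row R n.+1 l).
Local Notation B k := (burau_mx t n.+1 k).
Local Notation A m := (coxeter_mx t n m).

Lemma row_burau k l : (l < n.+1)%N ->
  e l *m B k = if l == k then (1 - t) *: e k + t *: e k.+1
               else if l == k.+1 then e k else e l.
Proof.
move=> ln; rewrite (unit_row_mul (Ordinal ln)); apply/rowP=> j; rewrite !mxE /=.
have kk1 : (k == k.+1) = false by rewrite ltn_eqF.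
case: (eqVneq l k) => _.
  rewrite !mxE; case: (eqVneq (j : nat) k) => [->|_]; last first.
    by case: eqP => _ /=; ring.
  by rewrite kk1 /=; ring.
case: (eqVneq l k.+1) => _; rewrite !mxE //.
by rewrite -val_eqE eq_sym.
Qed.

Lemma coxeter_mxS m : A m.+1 = A m *m B m.
Proof. by rewrite /coxeter_mx big_nat_recr. Qed.

(** Only the factor B l acts nontrivially here: the earlier ones fix e_(l+1),
    and the later ones fix its image e_l. *)
Lemma row_coxeterS m l : (l < n)%N ->
  e l.+1 *m A m = e (if l < m then l else l.+1)%N.
Proof.
move=> ln; elim: m => [|m IHm]; first by rewrite /coxeter_mx big_geq // mulmx1.
rewrite coxeter_mxS mulmxA IHm [in RHS]ltnS [in RHS]leq_eqVlt.
case: (ltngtP l m) => [lm|ml|lm] /=.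
- by rewrite row_burau ?ltnS 1?ltnW // (ltn_eqF lm) (ltn_eqF (leqW lm)).
- by rewrite row_burau ?ltnS // eqSS (gtn_eqF ml) (gtn_eqF (leqW ml)).
by rewrite lm row_burau ?ltnS -?lm // gtn_eqF // eqxx.
Qed.

(** Each generator keeps the fraction 1 - t of the mass that sits at its
    left strand and passes the fraction t on to the next strand. *)
Lemma row_coxeter0 m : (m <= n)%N ->
  e 0 *m A m = (1 - t) *: (\sum_(0 <= j < m) t ^+ j *: e j) + t ^+ m *: e m.
Proof.
elim: m => [|m IHm] mn.
  by rewrite /coxeter_mx !big_geq // mulmx1 scaler0 add0r scale1r.
rewrite coxeter_mxS mulmxA IHm ?(ltnW mn) // mulmxDl -!scalemxAl mulmx_suml.
rewrite [LHS]addrC [RHS]addrC row_burau ?ltnS 1?ltnW // eqxx big_nat_recr //=.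
rewrite [X in _ + _ *: X](_ : _ = \sum_(0 <= j < m) t ^+ j *: e j); last first.
  apply: eq_big_nat => j jm; rewrite -scalemxAl row_burau; last first.
    by rewrite ltnS (leq_trans (ltnW jm)) // ltnW.
  by rewrite (ltn_eqF jm) (ltn_eqF (leqW jm)).
by set s := \sum_(0 <= j < m) _; apply/rowP=> i; rewrite !mxE exprS; ring.
Qed.

Lemma coxeter0_telescope m : (m <= n)%N ->
  e 0 *m A m = e 0 - \sum_(0 <= j < m) t ^+ j.+1 *: d j.
Proof.
move=> mn; rewrite row_coxeter0 //; elim: m mn => [|m IHm] mn.
  by rewrite !big_geq // scaler0 add0r scale1r subr0.
rewrite !big_nat_recr //= opprD addrA -IHm ?(ltnW mn) //.
by set s := \sum_(0 <= j < m) _; apply/rowP=> i; rewrite !mxE exprS; ring.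
Qed.

Lemma diff_coxeterS l : (l.+1 < n)%N -> d l.+1 *m A n = d l.
Proof. by move=> ln; rewrite mulmxBl !row_coxeterS // ?ln ltnW. Qed.

Lemma diff_coxeterX l m : (l + m < n)%N -> d (l + m) *m (A n ^+ m) = d l.
Proof.
elim: m => [|m IHm] lmn; first by rewrite addn0 mulmx1.
move: lmn; rewrite addnS => lmn.
by rewrite exprS -mulmxE mulmxA diff_coxeterS // IHm // ltnW.
Qed.

Lemma unit_coxeterX m : (m <= n)%N -> e m *m (A n ^+ m) = e 0.
Proof.
elim: m => [|m IHm] mn; first by rewrite mulmx1.
by rewrite exprS -mulmxE mulmxA row_coxeterS // mn IHm // ltnW.
Qed.

Lemma diff0_coxeter : (0 < n)%N ->
  d 0 *m A n = - \sum_(0 <= j < n) t ^+ j.+1 *: d j.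
Proof.
move=> n0; rewrite mulmxBl (row_coxeterS _ n0) n0 coxeter0_telescope //.
by rewrite addrC addKr.
Qed.

End Coxeter.

(** Applying A to d_0 A = - \sum_l t^(l+1) d_l shifts the sum by one index, so
    it cancels against t times the original one except for its last term. *)
Lemma diff_coxeter0 (R : comNzRingType) (t : R) (n : nat) :
  let A := coxeter_mx t n.+1 n.+1 in
  diff_row R n.+2 0 *m A *m A = t ^+ n.+2 *: diff_row R n.+2 n.
Proof.
move=> A; rewrite {1}diff0_coxeter // big_nat_recl // mulNmx mulmxDl mulmx_suml.
rewrite -scalemxAl diff0_coxeter // big_nat_recr //=.
rewrite [X in _ + X](_ : _ =
    t *: (\sum_(0 <= j < n) t ^+ j.+1 *: diff_row R n.+2 j)).
  by set s := \sum_(0 <= j < n) _; apply/rowP=> i; rewrite !mxE !exprS; ring.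
rewrite scaler_sumr; apply: eq_big_nat => j jn.
by rewrite -scalemxAl diff_coxeterS // scalerA -exprS.
Qed.

(** The cycle of the differences is closed by diff_coxeter0, which accounts for
    two of the n.+2 steps. *)
Lemma diff_full_twist (R : comNzRingType) (t : R) (n l : nat) : (l <= n)%N ->
  diff_row R n.+2 l *m (coxeter_mx t n.+1 n.+1 ^+ n.+2)
    = t ^+ n.+2 *: diff_row R n.+2 l.
Proof.
move=> ln; set A := coxeter_mx _ _ _.
have -> : A ^+ n.+2 = A ^+ l * A ^+ 2 * A ^+ (n - l).
  by rewrite -!exprD addnAC subnKC // addn2.
(* Counting from l: l steps down to 0, two steps across, then n - l steps. *)
have dl : diff_row R n.+2 l *m A ^+ l = diff_row R n.+2 0.
  exact: (@diff_coxeterX R t n.+1 0 l).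
have dn : diff_row R n.+2 n *m A ^+ (n - l) = diff_row R n.+2 l.
  by have := @diff_coxeterX R t n.+1 l (n - l); rewrite subnKC //; apply.
by rewrite expr2 -!mulmxE !mulmxA dl diff_coxeter0 -scalemxAl dn.
Qed.

Lemma full_twist_mxE (R : comNzRingType) (t : R) (n : nat) :
  coxeter_mx t n.+1 n.+1 ^+ n.+2 = (t ^+ n.+2)%:M + (1 - t) *: geom_mx t n.+2.
Proof.
set A := coxeter_mx _ _ _; set C := A ^+ n.+2 - (t ^+ n.+2)%:M.
(* C kills the differences, so its rows are equal. *)
have dC l : (l <= n)%N ->
    unit_row R n.+2 l *m C = unit_row R n.+2 l.+1 *m C.
  move=> ln; apply/eqP; rewrite -subr_eq0 -mulmxBl -/(diff_row R n.+2 l).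
  by rewrite mulmxBr diff_full_twist // mul_mx_scalar subrr.
(* Column n.+1 of this row is t ^+ n.+1 - t ^+ n.+2, in line with the others. *)
have lastC : unit_row R n.+2 n.+1 *m C = (1 - t) *: geom_row t n.+2.
  rewrite mulmxBr mul_mx_scalar exprSr -mulmxE mulmxA unit_coxeterX //.
  rewrite row_coxeter0 // geom_rowE [in RHS]big_nat_recr //=.
  by set s := \sum_(0 <= j < _) _; apply/rowP=> i; rewrite !mxE !exprS; ring.
have allC m l : (l + m)%N = n.+1 ->
    unit_row R n.+2 l *m C = (1 - t) *: geom_row t n.+2.
  elim: m l => [|m IHm] l; first by rewrite addn0 => ->.
  rewrite addnS => -[lm]; have ln : (l <= n)%N by rewrite -lm leq_addr.
  by rewrite dC // IHm // addSn lm.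
apply/eqP; rewrite addrC -subr_eq -/C; apply/eqP/row_matrixP=> i.
rewrite -unit_row_mul (allC (n.+1 - i)%N) ?subnKC // -1?ltnS //.
by apply/rowP=> j; rewrite !mxE.
Qed.

(** geom_mx is the column of ones times geom_row, and geom_row times that
    column is the geometric sum. *)
Lemma geom_mxM (R : comNzRingType) (t : R) (n : nat) :
  geom_mx t n *m geom_mx t n = (\sum_(m < n) t ^+ m) *: geom_mx t n.
Proof.
apply/matrixP=> i j; rewrite !mxE mulr_suml.
by apply: eq_bigr => m _; rewrite !mxE.
Qed.

Lemma geom_sum (R : comNzRingType) (t : R) (n : nat) :
  (1 - t) * (\sum_(m < n) t ^+ m) = 1 - t ^+ n.
Proof. by rewrite -opprB mulNr -subrX1 opprB. Qed.

(** The coefficient of geom_mx gains (1 - t) t^(n k) at each step, because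
    (1 - t) times the geometric sum is 1 - t^n. *)
Lemma full_twist_mxX (R : comNzRingType) (t : R) (n k : nat) :
  ((t ^+ n.+1)%:M + (1 - t) *: geom_mx t n.+1) ^+ k
  = (t ^+ (n.+1 * k))%:M
      + ((1 - t) * \sum_(l < k) t ^+ (n.+1 * l)) *: geom_mx t n.+1.
Proof.
elim: k => [|k IHk]; first by rewrite muln0 big_ord0 mulr0 scale0r addr0.
rewrite exprSr IHk -mulmxE mulmxDl !mulmxDr -!scalemxAl -!scalemxAr geom_mxM.
rewrite -scalar_mxM -exprD addnC -mulnS mul_mx_scalar mul_scalar_mx !scalerA.
rewrite -!addrA -!scalerDl; congr (_ + _ *: _).
rewrite -[X in _ + (_ + X)]mulrA geom_sum [in RHS]big_ord_recr /=; ring.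
Qed.

Lemma gl_valX (R : comUnitRingType) (n m : nat) (g : general_linear R n.+1) :
  gl_val (g ^+ m)%g = gl_val g ^+ m.
Proof. by elim: m => [|m IHm] //; rewrite expgS exprS /= IHm. Qed.

Lemma gl_val_prod (R : comUnitRingType) (n m : nat)
    (g : 'I_m -> general_linear R n.+1) :
  gl_val (\prod_(k < m) g k)%g = \prod_(k < m) gl_val (g k).
Proof. exact: (big_morph (@gl_val R n.+1) (fun _ _ => erefl) erefl). Qed.

Lemma burau_full_twist (n : nat) :
  gl_val (burau (full_twist n.+1)) = coxeter_mx varT n n ^+ n.+1.
Proof.
rewrite /full_twist gmulfXn gl_valX; congr (_ ^+ _).
rewrite gmulf_prod gl_val_prod /coxeter_mx big_mkord.
by apply: eq_bigr => k _; rewrite burau_sigma.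
Qed.

Theorem proposition4p5 (k n : nat) (hk : (1 <= k)%N) (hn : (2 <= n)%N)
    (i j : 'I_n) :
  gl_val (burau (full_twist n ^+ k)%g) i j =
    if i != j then varT ^+ j * burau_p n k
    else 1 - burau_p n k * \sum_(m < n | m != i) varT ^+ m.
Proof.
case: n hn i j => [|[|n]] // _ i j.
rewrite gmulfXn gl_valX burau_full_twist full_twist_mxE full_twist_mxX !mxE.
rewrite -/(burau_p _ _); case: (eqVneq i j) => [<-|_] /=; last first.
  by rewrite mulr0n add0r mulrC.
have pS : burau_p n.+2 k * (\sum_(m < n.+2) varT ^+ m) = 1 - varT ^+ (n.+2 * k).
  rewrite /burau_p mulrAC geom_sum exprM -[RHS]geom_sum; congr (_ * _).
  by apply: eq_bigr => l _; rewrite exprM.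
move: pS; rewrite (bigD1 i) //= mulrDr mulr1n.
by move=> /(canRL (addKr _)) ->; ring.
Qed.
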